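(* Let $0<\alpha<1$ and $p,q>0$. If $\lambda_1(SG_{\alpha,p}(A,B))\le\lambda_1(\mathcal{A}_{\alpha,q}(A,B))$ holds for all positive definite $2\times2$ matrices $A,B$, then $q/p\ge\max\{\alpha,1-\alpha\}$. Hence, if $SG_{\alpha,p}(A,B)\prec_w\mathcal{A}_{\alpha,q}(A,B)$ for all positive definite $2\times2$ matrices $A,B$, then $q/p\ge\max\{\alpha,1-\alpha\}$.
   Context: For positive definite $A,B$: $A\#B:=A^{1/2}(A^{-1/2}BA^{-1/2})^{1/2}A^{1/2}$; $F_\alpha(A,B):=(A^{-1}\#B)^\alpha A(A^{-1}\#B)^\alpha$; $SG_{\alpha,p}(A,B):=F_\alpha(A^p,B^p)^{1/p}$; $\mathcal{A}_{\alpha,q}(A,B):=((1-\alpha)A^q+\alpha B^q)^{1/q}$. For an $n\times n$ positive semidefinite $X$, $\lambda_1(X)\ge\dots\ge\lambda_n(X)$ are its eigenvalues in decreasing order with multiplicities. $X\prec_wY$ (weak majorization) means $\sum_{i=1}^k\lambda_i(X)\le\sum_{i=1}^k\lambda_i(Y)$ for $1\le k\le n$. *)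

(* Defs.v *)
(* matrices over the complex numbers R[i] for R : realType. *)
From HB Require Import structures.
From mathcomp Require Import all_boot all_order all_algebra.
From mathcomp Require Import sesquilinear spectral.
From mathcomp Require Import complex.
From mathcomp Require Import reals exp.

Set Implicit Arguments.
Unset Strict Implicit.
Unset Printing Implicit Defensive.

Import Order.TTheory GRing.Theory Num.Theory.
Local Open Scope ring_scope.
Local Open Scope sesquilinear_scope.
Local Open Scope complex_scope.

Section Defs.
Variable R : realType.
Local Notation C := (R[i]).

(* positive definite (Hermitian) matrices *)
Definition posdefmx n (A : 'M[C]_n) : Prop :=
  A \is hermsymmx /\ forall v : 'rV[C]_n, v != 0 -> 0 < (v *m A *m v ^t*) 0 0.

(* real power X^t of a Hermitian (normal) matrix X, via the spectral
   decomposition X = U^-1 diag(d) U of the library (U unitary):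
   X^t := U^-1 diag(d_i^t) U, d_i^t the real power (powR) of the real
   eigenvalue d_i *)
Definition mpow n (X : 'M[C]_n) (t : R) : 'M[C]_n :=
  invmx (spectralmx X) *m
    diag_mx (map_mx (fun z : C => ((complex.Re z) `^ t)%:C) (spectral_diag X))
  *m spectralmx X.

(* matrix geometric mean A # B *)
Definition gmean n (A B : 'M[C]_n) : 'M[C]_n :=
  mpow A (1/2) *m
    mpow (mpow A (-(1/2)) *m B *m mpow A (-(1/2))) (1/2) *m mpow A (1/2).

(* F_alpha(A,B) = (A^-1 # B)^alpha A (A^-1 # B)^alpha *)
Definition Falpha n (alpha : R) (A B : 'M[C]_n) : 'M[C]_n :=
  mpow (gmean (invmx A) B) alpha *m A *m mpow (gmean (invmx A) B) alpha.

(* SG_{alpha,p}(A,B) = F_alpha(A^p,B^p)^{1/p} *)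
Definition SG n (alpha p : R) (A B : 'M[C]_n) : 'M[C]_n :=
  mpow (Falpha alpha (mpow A p) (mpow B p)) (1 / p).

(* A_{alpha,q}(A,B) = ((1-alpha) A^q + alpha B^q)^{1/q} *)
Definition Amean n (alpha q : R) (A B : 'M[C]_n) : 'M[C]_n :=
  mpow ((1 - alpha)%:C *: mpow A q + alpha%:C *: mpow B q) (1 / q).

(* eigenvalues (with multiplicities, real parts; real for Hermitian X)
   in decreasing order; lam X i = lambda_{i+1}(X) (0-based index) *)
Definition eigs n (X : 'M[C]_n) : seq R :=
  sort (fun x y : R => y <= x)
    [seq complex.Re (spectral_diag X 0 i) | i <- enum 'I_n].

Definition lam n (X : 'M[C]_n) (i : nat) : R := nth 0 (eigs X) i.

(* weak majorization X <_w Y *)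
Definition wmaj n (X Y : 'M[C]_n) : Prop :=
  forall k : nat, (1 <= k <= n)%N ->
    \sum_(i < k) lam X i <= \sum_(i < k) lam Y i.

End Defs.

(* Main.v *)
(* Put r = q/p, P = A^p and let X solve the Riccati equation B^p = X P X, so
   that X = A^-p # B^p. The hypothesis then bounds the top eigenvalue of
   (X^alpha P X^alpha)^r by that of (1 - alpha) P^r + alpha (X P X)^r. Take
   X = diag(1, 1/e) and X P X = w w^T + e I with w = (1, t). The (0,0) entry of
   X^alpha P X^alpha is 1 + e, whereas as e -> 0 the mixture tends to
   (1 - alpha) E_00 + alpha (1 + t^2)^(r-1) w w^T, whose eigenvalues are all
   below 1 for small t as soon as r < 1 - alpha. Hence r >= 1 - alpha, and
   exchanging the roles of A and B (X becomes X^-1) gives r >= alpha. *)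
Require Import Defs.
From HB Require Import structures.
From mathcomp Require Import all_boot all_order all_algebra.
From mathcomp Require Import sesquilinear spectral complex.
From mathcomp Require Import reals exp ring lra.

Import Order.TTheory GRing.Theory Num.Theory.
Local Open Scope ring_scope.

(** * Purely algebraic identities for diagonalizable matrices *)

Section MatrixAlgebra.
Set Implicit Arguments.
Unset Strict Implicit.

Lemma mulmx_conj (K : comUnitRingType) n (U D E : 'M[K]_n) : U \in unitmx ->
  (invmx U *m D *m U) *m (invmx U *m E *m U) = invmx U *m (D *m E) *m U.
Proof. by move=> UU; rewrite !mulmxA mulmxK. Qed.

(* Two diagonalizations of a matrix are intertwined by [W := V *m invmx U],
   whose entry [W i j] vanishes unless [a i = b j]. *)
Lemma diag_calculus_unique (K : fieldType) n (U V : 'M[K]_n) (a b c d : 'rV[K]_n) :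
  U \in unitmx -> V \in unitmx ->
  invmx V *m diag_mx a *m V = invmx U *m diag_mx b *m U ->
  (forall i j, a 0 i = b 0 j -> c 0 i = d 0 j) ->
  invmx V *m diag_mx c *m V = invmx U *m diag_mx d *m U.
Proof.
move=> UU VU ab cd; set W := V *m invmx U.
have abW : diag_mx a *m W = W *m diag_mx b.
  apply: (can_inj (mulmxK UU)); apply: (can_inj (mulKmx (_ : invmx V \in unitmx))).
    by rewrite unitmx_inv.
  by rewrite /W !mulmxA mulVmx // mul1mx mulmxKV.
have cdW : diag_mx c *m W = W *m diag_mx d.
  apply/matrixP => i j; move/matrixP/(_ i j): abW.
  rewrite 2!mul_diag_mx 2!mul_mx_diag [_ i j]mxE [_ i j in RHS]mxE => abW.
  rewrite [LHS]mxE [RHS]mxE; have [->|Wij] := eqVneq (W i j) 0.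
    by rewrite mulr0 mul0r.
  by rewrite (cd i j) 1?mulrC //; apply: (mulIf Wij); rewrite abW mulrC.
have VE : V = W *m U by rewrite /W mulmxKV.
rewrite [X in _ *m X = _]VE mulmxA -(mulmxA _ _ W) cdW.
by rewrite /W !mulmxA mulVmx // mul1mx.
Qed.

Lemma riccati_sqr (K : pzSemiRingType) n (S P X : 'M[K]_n) : S *m S = P ->
  S *m (X *m P *m X) *m S = (S *m X *m S) *m (S *m X *m S).
Proof. by move=> <-; rewrite !mulmxA. Qed.

Lemma mulmx_sandwichK (K : pzSemiRingType) n (S T X : 'M[K]_n) :
  T *m S = 1%:M -> S *m T = 1%:M -> T *m (S *m X *m S) *m T = X.
Proof. by move=> TS ST; rewrite !mulmxA TS mul1mx -mulmxA ST mulmx1. Qed.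

End MatrixAlgebra.

(** * Functional calculus and quadratic forms of Hermitian matrices *)

Section SpectralCalculus.
Set Implicit Arguments.
Unset Strict Implicit.
Local Open Scope sesquilinear_scope.
Local Open Scope complex_scope.
Variable R : realType.
Local Notation C := (R[i]).

(** Valued in [R] rather than [C], as are [sqnorm] and [rform], so that all later estimates take
    place in an ordered field. *)
Definition sqmod (z : C) : R := complex.Re z ^+ 2 + complex.Im z ^+ 2.

Definition sqnorm n (v : 'rV[C]_n) : R := \sum_i sqmod (v 0 i).

Definition rform n (M : 'M[C]_n) (v : 'rV[C]_n) : R :=
  complex.Re ((v *m M *m v ^t*) 0 0).

(** Unlike [spectralmx], the diagonalizing matrix [U] is free, so spectral data may be chosen at
    will. *)
Definition udiag n (U : 'M[C]_n) (d : 'I_n -> R) : 'M[C]_n :=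
  invmx U *m diag_mx (\row_i (d i)%:C) *m U.

Lemma sqmod_ge0 z : 0 <= sqmod z.
Proof. by rewrite addr_ge0 ?sqr_ge0. Qed.

Lemma sqmod_eq0 z : sqmod z = 0 -> z = 0.
Proof.
case: z => x y /eqP; rewrite paddr_eq0 ?sqr_ge0 // !sqrf_eq0 /=.
by case/andP => /eqP -> /eqP ->.
Qed.

Lemma mulr_conjC (z : C) : z * Num.conj z = (sqmod z)%:C.
Proof. by rewrite -normCK -add_Re2_Im2. Qed.

Lemma hermsymmxP n (M : 'M[C]_n) : reflect (M ^t* = M) (M \is hermsymmx).
Proof.
by apply: (iffP (is_hermitianmxP _ _ _)); rewrite expr0 scale1r => /esym.
Qed.

Lemma rformD n (M N : 'M[C]_n) v : rform (M + N) v = rform M v + rform N v.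
Proof. by rewrite /rform mulmxDr mulmxDl mxE raddfD. Qed.

Lemma rformZ n a (M : 'M[C]_n) v : rform (a%:C *: M) v = a * rform M v.
Proof.
rewrite /rform -scalemxAr -scalemxAl mxE.
by case: ((_ *m _) 0 0) => x y /=; rewrite mul0r subr0.
Qed.

Lemma eq_udiag n (U : 'M[C]_n) d e : d =1 e -> udiag U d = udiag U e.
Proof.
move=> de; rewrite /udiag; have -> // : \row_i (d i)%:C = \row_i (e i)%:C.
by apply/rowP => i; rewrite !mxE de.
Qed.

Section Unitary.
Variables (n : nat) (U : 'M[C]_n).
Hypothesis U_unitary : U \is unitarymx.

(** As [invmx U = U ^t*], the form becomes diagonal in the eigenbasis coordinates [v *m U ^t*]. *)
Lemma udiag_form d (v : 'rV[C]_n) :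
  (v *m udiag U d *m v ^t*) 0 0 =
  (\sum_i d i * sqmod ((v *m U ^t*) 0 i))%:C.
Proof.
have -> : v *m udiag U d *m v ^t* =
    (v *m U ^t*) *m diag_mx (\row_i (d i)%:C) *m (v *m U ^t*) ^t*.
  by rewrite /udiag invmx_unitary // trmx_mul map_mxM trmxCK !mulmxA.
rewrite mxE rmorph_sum /=; apply: eq_bigr => i _.
by rewrite mul_mx_diag !mxE rmorphM /= -mulr_conjC mulrAC mulrC.
Qed.

Lemma udiag_rform d (v : 'rV[C]_n) :
  rform (udiag U d) v = \sum_i d i * sqmod ((v *m U ^t*) 0 i).
Proof. by rewrite /rform udiag_form. Qed.

Lemma udiag1 : udiag U (fun=> 1) = 1%:M.
Proof.
rewrite /udiag (_ : \row__ _ = const_mx 1); last by apply/rowP => i; rewrite !mxE.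
by rewrite diag_const_mx mulmx1 mulVmx // unitarymx_unit.
Qed.

Lemma form1_sqnorm (v : 'rV[C]_n) : (v *m v ^t*) 0 0 = (sqnorm v)%:C.
Proof.
by rewrite mxE rmorph_sum; apply: eq_bigr => i _; rewrite !mxE mulr_conjC.
Qed.

(** Parseval, read off from [udiag_form] with all eigenvalues equal to 1. *)
Lemma sqnorm_unitary (v : 'rV[C]_n) : sqnorm (v *m U ^t*) = sqnorm v.
Proof.
have /(congr1 (@complex.Re R)) := udiag_form (fun=> 1) v.
rewrite udiag1 mulmx1 form1_sqnorm /= => ->.
by apply: eq_bigr => i _; rewrite mul1r.
Qed.

Lemma row_unitary_coord i j : (row i U *m U ^t*) 0 j = (i == j)%:R.
Proof. by rewrite -row_mul (unitarymxP U_unitary) !mxE. Qed.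

Lemma sqnorm_row_unitary i : sqnorm (row i U) = 1.
Proof.
rewrite -sqnorm_unitary /sqnorm (bigD1 i) //= row_unitary_coord eqxx.
rewrite big1 => [|j jDi]; first by rewrite /sqmod /= expr0n expr1n !addr0.
by rewrite row_unitary_coord eq_sym (negPf jDi) /sqmod /= expr0n addr0.
Qed.

Lemma udiag_rform_row d i : rform (udiag U d) (row i U) = d i.
Proof.
rewrite udiag_rform (bigD1 i) //= row_unitary_coord eqxx.
rewrite big1 => [|j jDi]; first by rewrite /sqmod /= expr0n expr1n !addr0 mulr1.
by rewrite row_unitary_coord eq_sym (negPf jDi) /sqmod /= expr0n addr0 mulr0.
Qed.

Lemma udiag_hermsym d : udiag U d \is hermsymmx.
Proof.
apply/hermsymmxP; rewrite /udiag invmx_unitary //.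
set D := diag_mx _; have DC : D ^t* = D.
  rewrite /D tr_diag_mx map_diag_mx; congr diag_mx.
  apply/rowP => i; rewrite !mxE; apply: conj_Creal.
  by apply/complex_realP; exists (d i).
by rewrite trmx_mul trmx_mul map_mxM map_mxM DC trmxCK mulmxA.
Qed.

Lemma udiagM d e : udiag U d *m udiag U e = udiag U (fun i => d i * e i).
Proof.
rewrite /udiag mulmx_conj; last exact: unitarymx_unit.
have -> // : diag_mx (\row_i (d i)%:C) *m diag_mx (\row_i (e i)%:C) =
    diag_mx (\row_i (d i * e i)%:C).
by rewrite mulmx_diag; congr diag_mx; apply/rowP => i; rewrite !mxE rmorphM.
Qed.

(** [mpow] is built on one particular spectral decomposition; by [diag_calculus_unique] every
    unitary diagonalization yields the same power. All the power laws below rest on this. *)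
Lemma mpow_udiag d t : mpow (udiag U d) t = udiag U (fun i => d i `^ t).
Proof.
have /orthomx_spectralP XE := hermitian_normalmx (udiag_hermsym d).
have UU := unitarymx_unit U_unitary.
apply: diag_calculus_unique UU (spectral_unit _) (esym XE) _ => i j.
by rewrite !mxE => ->.
Qed.

Lemma posdef_udiag d : (forall i, 0 < d i) -> posdefmx (udiag U d).
Proof.
move=> d_gt0; split=> [|v v_neq0]; first exact: udiag_hermsym.
rewrite udiag_form ltcR lt_def sumr_ge0 ?andbT; last first.
  by move=> i _; rewrite mulr_ge0 ?sqmod_ge0 // ltW.
apply/eqP => s0; move/eqP: v_neq0; apply.
have UU : U ^t* \in unitmx by apply: unitarymx_unit; rewrite trmxC_unitary.
apply: (can_inj (mulmxK UU)); rewrite mul0mx; apply/rowP => i; rewrite [RHS]mxE.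
move/eqP: s0; rewrite psumr_eq0; last first.
  by move=> j _; rewrite mulr_ge0 ?sqmod_ge0 // ltW.
move=> /allP/(_ i (mem_index_enum _)) /=.
by rewrite mulf_eq0 (gt_eqF (d_gt0 i)) /= => /eqP /sqmod_eq0.
Qed.

End Unitary.

(** Each [d i] is the value of the form at the unit eigenvector [row i U], hence positive. The last
    clause links [d] to [lam]. *)
Lemma posdef_ex_udiag n (X : 'M[C]_n) : posdefmx X ->
  exists U d, [/\ U \is unitarymx, forall i, 0 < d i,
    X = udiag U d & forall i, d i = complex.Re (spectral_diag X 0 i)].
Proof.
move=> [Xh Xpos]; have UX := spectral_unitarymx X.
pose d i := complex.Re (spectral_diag X 0 i).
have XE : X = udiag (spectralmx X) d.
  have /orthomx_spectralP {1}-> := hermitian_normalmx Xh.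
  have -> : spectral_diag X = \row_i (d i)%:C.
    apply/rowP => i; rewrite mxE RRe_real //.
    exact: (mxOverP (hermitian_spectral_diag_real Xh)).
  by rewrite -/(udiag _ _).
exists (spectralmx X), d; split => // i.
have v0 : row i (spectralmx X) != 0.
  apply/eqP => r0; have := sqnorm_row_unitary UX i.
  rewrite r0 /sqnorm big1 => [/eqP|j _]; first by rewrite eq_sym oner_eq0.
  by rewrite mxE /sqmod /= expr0n addr0.
have := Xpos _ v0; rewrite ltcE => /andP[_].
by rewrite -/(rform _ _) {1}XE udiag_rform_row.
Qed.

Lemma posdef_mpow n (X : 'M[C]_n) t : posdefmx X -> posdefmx (mpow X t).
Proof.
move=> /posdef_ex_udiag[U [d [UU d0 -> _]]]; rewrite (mpow_udiag UU).
by apply: posdef_udiag => // i; apply: powR_gt0.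
Qed.

Lemma mpow_mpow n (X : 'M[C]_n) s t : posdefmx X ->
  mpow (mpow X s) t = mpow X (s * t).
Proof.
move=> /posdef_ex_udiag[U [d [UU d0 -> _]]].
have e1 := congr1 (fun Y => mpow Y t) (mpow_udiag UU d s).
have e2 := mpow_udiag UU (fun i => d i `^ s) t.
have e3 := mpow_udiag UU d (s * t).
have e4 : udiag U (fun i => d i `^ s `^ t) = udiag U (fun i => d i `^ (s * t)).
  by apply: eq_udiag => i; rewrite powRrM.
exact: (etrans e1 (etrans e2 (etrans e4 (esym e3)))).
Qed.

Lemma mpow1 n (X : 'M[C]_n) : posdefmx X -> mpow X 1 = X.
Proof.
move=> /posdef_ex_udiag[U [d [UU d0 -> _]]]; rewrite !(mpow_udiag UU).
by apply: eq_udiag => i; rewrite powRr1 // ltW.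
Qed.

Lemma mpowK n (X : 'M[C]_n) t : t != 0 -> posdefmx X ->
  mpow (mpow X (1 / t)) t = X.
Proof. by move=> t0 X0; rewrite mpow_mpow // divfK // mpow1. Qed.

Lemma mpowKV n (X : 'M[C]_n) t : t != 0 -> posdefmx X ->
  mpow (mpow X t) (1 / t) = X.
Proof. by move=> t0 X0; rewrite mpow_mpow // div1r mulfV // mpow1. Qed.

Lemma mpowD n (X : 'M[C]_n) s t : posdefmx X ->
  mpow X s *m mpow X t = mpow X (s + t).
Proof.
move=> /posdef_ex_udiag[U [d [UU d0 -> _]]]; rewrite !(mpow_udiag UU) (udiagM UU).
by apply: eq_udiag => i; rewrite powRD // (gt_eqF (d0 i)) implybT.
Qed.

Lemma mpow0 n (X : 'M[C]_n) : posdefmx X -> mpow X 0 = 1%:M.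
Proof.
move=> /posdef_ex_udiag[U [d [UU d0 -> _]]]; rewrite (mpow_udiag UU) -(udiag1 UU).
by apply: eq_udiag => i; rewrite powRr0.
Qed.

(** Turns the inverse inside [Falpha] into a power, to which [mpow_mpow] applies. *)
Lemma invmx_mpow n (X : 'M[C]_n) : posdefmx X -> invmx X = mpow X (-1).
Proof.
move=> X0; have XV : mpow X (-1) *m X = 1%:M.
  by rewrite -[X in _ *m X]mpow1 // mpowD // addNr mpow0.
have [_ Xu] := mulmx1_unit XV.
by rewrite -[invmx X]mul1mx -XV mulmxK.
Qed.

Lemma posdef_hermC n (X : 'M[C]_n) : posdefmx X -> X ^t* = X.
Proof. by case=> /hermsymmxP. Qed.

Lemma posdef_unit n (X : 'M[C]_n) : posdefmx X -> X \in unitmx.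
Proof.
move=> X0; suff /mulmx1_unit[] : X *m mpow X (-1) = 1%:M by [].
by rewrite -{1}[X]mpow1 // mpowD // subrr mpow0.
Qed.

Lemma form_congr n (S X : 'M[C]_n) (v : 'rV[C]_n) : S ^t* = S ->
  v *m (S *m X *m S) *m v ^t* = (v *m S) *m X *m (v *m S) ^t*.
Proof. by move=> Sh; rewrite trmx_mul map_mxM Sh !mulmxA. Qed.

Lemma posdef_congr n (S X : 'M[C]_n) : posdefmx S -> posdefmx X ->
  posdefmx (S *m X *m S).
Proof.
move=> S0 [Xh Xpos]; have Sh := posdef_hermC S0; split => [|v v0].
  by apply/hermsymmxP; rewrite !trmx_mul !map_mxM Sh (hermsymmxP _ Xh) mulmxA.
rewrite (form_congr _ _ Sh).
apply: Xpos; apply: contra_neq v0 => vS0.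
by rewrite -[v](mulmxK (posdef_unit S0)) vS0 mul0mx.
Qed.

Lemma mpow2 n (X : 'M[C]_n) : posdefmx X -> mpow X 2 = X *m X.
Proof. by move=> X0; rewrite -{2 3}[X]mpow1 // mpowD. Qed.

(* [X] solves the Riccati equation [Y P Y = X P X], whose unique positive
   solution is [P^-1 # (X P X)]. *)
Lemma gmean_riccati n (P X : 'M[C]_n) : posdefmx P -> posdefmx X ->
  gmean (invmx P) (X *m P *m X) = X.
Proof.
move=> P0 X0; rewrite invmx_mpow // /gmean !mpow_mpow //.
rewrite !mulN1r opprK.
set S := mpow P (1 / 2); set T := mpow P (- (1 / 2)).
have S0 : posdefmx S by apply: posdef_mpow.
have ST : S *m T = 1%:M by rewrite /S /T mpowD // subrr mpow0.
have TS : T *m S = 1%:M by rewrite /S /T mpowD // addNr mpow0.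
have SS : S *m S = P.
  by rewrite /S mpowD // -splitr mpow1.
(* Since [S *m S = P], the matrix under the root is the square of the positive definite
   [S *m X *m S]. The outer factors [T] then cancel both [S]. *)
have sqrtY : mpow (S *m (X *m P *m X) *m S) (1 / 2) = S *m X *m S.
  have Y0 := posdef_congr S0 X0; rewrite (riccati_sqr X SS) -(mpow2 Y0).
  by apply: mpowKV Y0; rewrite pnatr_eq0.
by rewrite sqrtY; apply: mulmx_sandwichK.
Qed.

Lemma Falpha_riccati n alpha (P X : 'M[C]_n) : posdefmx P -> posdefmx X ->
  Falpha alpha P (X *m P *m X) = mpow X alpha *m P *m mpow X alpha.
Proof. by move=> P0 X0; rewrite /Falpha gmean_riccati. Qed.

(** * Variational description of the top eigenvalue *)

Lemma lam0_eigenvalue n (X : 'M[C]_n.+1) :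
  exists i, lam X 0 = complex.Re (spectral_diag X 0 i).
Proof.
have : lam X 0 \in eigs X.
  by rewrite mem_nth // size_sort size_map size_enum_ord.
by rewrite mem_sort => /mapP[i _ ->]; exists i.
Qed.

Lemma eigenvalue_le_lam0 n (X : 'M[C]_n.+1) i :
  complex.Re (spectral_diag X 0 i) <= lam X 0.
Proof.
have : complex.Re (spectral_diag X 0 i) \in eigs X.
  by rewrite mem_sort; apply: map_f; rewrite mem_enum.
have : sorted (fun x y : R => y <= x) (eigs X).
  by apply: sort_sorted => x y; apply: le_total.
rewrite /lam; case: (eigs X) => [//|a s] /= /order_path_min a_max.
rewrite inE => /orP[/eqP -> //|].
by move: (a_max (fun x y z xy yz => le_trans yz xy)) => /allP; apply.
Qed.

Lemma rform_mpow_le n (X : 'M[C]_n.+1) t v : posdefmx X -> 0 <= t ->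
  rform (mpow X t) v <= lam X 0 `^ t * sqnorm v.
Proof.
move=> X0 t0; have [U [d [UU d0 XE dE]]] := posdef_ex_udiag X0.
rewrite [in mpow _ _]XE (mpow_udiag UU) (udiag_rform UU) -(sqnorm_unitary UU).
rewrite mulr_sumr; apply: ler_sum => i _.
rewrite ler_wpM2r ?sqmod_ge0 // ge0_ler_powR ?nnegrE // ?(ltW (d0 i)) //.
- by apply: le_trans (eigenvalue_le_lam0 X i); rewrite -dE ltW.
- by rewrite dE eigenvalue_le_lam0.
Qed.

(** A unit eigenvector for the top eigenvalue of [X] serves every exponent. *)
Lemma rform_mpow_lam0 n (X : 'M[C]_n.+1) t : posdefmx X ->
  exists v, sqnorm v = 1 /\ rform (mpow X t) v = lam X 0 `^ t.
Proof.
move=> X0; have [U [d [UU d0 XE dE]]] := posdef_ex_udiag X0.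
have [i ->] := lam0_eigenvalue X; exists (row i U); split.
  exact: sqnorm_row_unitary.
by rewrite -dE [in mpow _ _]XE (mpow_udiag UU) (udiag_rform_row UU).
Qed.

End SpectralCalculus.

(** * Scalar inequalities *)

Section RealInequalities.
Set Implicit Arguments.
Unset Strict Implicit.
Variable R : realType.
Implicit Types (r a h m x y : R).

(** The last hypothesis says that [m] separates [x] and [y]. If [m <= x], then [x]^ (r - 1) <= m
    [^ (r - 1)] and the first term suffices; otherwise [m <= y], so [x <= x * y / m] and the second
    one does. Below, [x] and [y] are the eigenvalues of a 2 by 2 matrix and [x * y] is its
    determinant. *)
Lemma powR_concave_bound r m x y : 0 < r <= 1 -> 0 < m -> 0 < x -> 0 < y ->
  (x - m) * (y - m) <= 0 -> x `^ r <= m `^ (r - 1) * x + (x * y / m) `^ r.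
Proof.
move=> /andP[r0 r1] m0 x0 y0 xym; have [mx|xm] := leP m x.
  have -> : x `^ r = x `^ (r - 1) * x.
    by rewrite mulrC mulr_powRB1 // ltW.
  rewrite -[X in X <= _]addr0 lerD ?powR_ge0 // ler_pM2r //.
  rewrite -[r - 1]opprB !powRN lef_pV2 ?posrE ?powR_gt0 //.
  by rewrite ge0_ler_powR ?nnegrE ?subr_ge0 // ltW.
have my : m <= y.
  by rewrite leNgt; apply/negP => ym; nra.
rewrite -[X in X <= _]add0r lerD ?mulr_ge0 ?powR_ge0 ?(ltW x0) //.
rewrite ge0_ler_powR ?nnegrE ?(ltW r0) ?(ltW x0) //.
  by rewrite divr_ge0 ?mulr_ge0 ?(ltW m0) ?(ltW x0) ?(ltW y0).
by rewrite ler_pdivlMr // ler_pM2l.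
Qed.

(* [h ^ s >= 1 + s ln h] and [ln h >= 1 - 1/h], so any [h > 1] with
   [a h < s] will do. *)
Lemma powR_gt_chord a s : 0 < a -> a < s ->
  exists2 h, 1 < h & 1 + a * (h - 1) < h `^ s.
Proof.
move=> a0 as_; exists ((1 + s / a) / 2).
  by rewrite ltr_pdivlMr // mul1r ltrD2l ltr_pdivlMr // mul1r.
set h := _ / 2; have h1 : 1 < h.
  by rewrite ltr_pdivlMr // mul1r ltrD2l ltr_pdivlMr // mul1r.
have h0 : 0 < h by apply: lt_trans h1.
have ah : a * h < s.
  have -> : a * h = (a + s) / 2 by rewrite /h; field; rewrite gt_eqF.
  lra.
have lnh : 1 - h^-1 <= ln h.
  have hV : -1 < h^-1 - 1 by rewrite ltrBDl subrr invr_gt0.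
  by have := le_ln1Dx hV; rewrite [1 + _]addrC subrK lnV ?posrE //; lra.
rewrite /powR gt_eqF //; apply: lt_le_trans (expR_ge1Dx _).
rewrite ltrD2l; apply: (@lt_le_trans _ _ (s * (1 - h^-1))); last first.
  by rewrite ler_pM2l // (lt_trans a0).
have -> : s * (1 - h^-1) = s / h * (h - 1) by field; rewrite gt_eqF.
by rewrite ltr_pM2r ?subr_gt0 // ltr_pdivlMr.
Qed.

(** The least eigenvalue of a positive definite 2 by 2 matrix [M] is at least det / trace: by
    Cayley-Hamilton [tr(M) M - det(M) I = M^2], whose form is the sum of two squares in the
    proof. *)
Lemma quadratic_ge a b c (x y : R) : 0 < a -> 0 < c -> 0 < a * c - b ^+ 2 ->
  (a * c - b ^+ 2) / (a + c) * (x ^+ 2 + y ^+ 2) <=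
    a * x ^+ 2 - 2 * b * x * y + c * y ^+ 2.
Proof.
move=> a0 c0 D0; have s0 : 0 < a + c by apply: addr_gt0.
rewrite mulrAC ler_pdivrMr // -subr_ge0.
have -> : (a * x ^+ 2 - 2 * b * x * y + c * y ^+ 2) * (a + c) -
    (a * c - b ^+ 2) * (x ^+ 2 + y ^+ 2) =
  (a * x - b * y) ^+ 2 + (b * x - c * y) ^+ 2 by ring.
by rewrite addr_ge0 ?sqr_ge0.
Qed.

End RealInequalities.

(** * Real symmetric 2 by 2 matrices *)

Section TwoByTwo.
Local Open Scope sesquilinear_scope.
Local Open Scope complex_scope.
Set Implicit Arguments.
Unset Strict Implicit.
Variable R : realType.
Local Notation C := (R[i]).
Implicit Types (a b c x y : R).

Definition symmx2 a b c : 'M[C]_2 :=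
  \matrix_(i, j) (if i == j then if i == 0 then a else c else b)%:C.

Definition qform a b c x y : R := a * x ^+ 2 + 2 * b * x * y + c * y ^+ 2.

(** For a real symmetric matrix the cross terms between real and imaginary parts cancel, so real
    estimates can be applied to each part separately. *)
Lemma symmx2_form a b c (v : 'rV[C]_2) : (v *m symmx2 a b c *m v ^t*) 0 0 =
  (qform a b c (complex.Re (v 0 0)) (complex.Re (v 0 1)) +
   qform a b c (complex.Im (v 0 0)) (complex.Im (v 0 1)))%:C.
Proof.
rewrite !mxE !big_ord_recl !big_ord0 !mxE !big_ord_recl !big_ord0 !mxE /=.
rewrite (_ : lift ord0 ord0 = 1); last exact/val_inj.
rewrite !addr0 /qform.
case: (v 0 0) (v 0 1) => [x0 y0] [x1 y1] /=.
by apply/eqP; rewrite eq_complex /=; apply/andP; split; apply/eqP; ring.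
Qed.

Lemma symmx2_rform a b c (v : 'rV[C]_2) : rform (symmx2 a b c) v =
  qform a b c (complex.Re (v 0 0)) (complex.Re (v 0 1)) +
  qform a b c (complex.Im (v 0 0)) (complex.Im (v 0 1)).
Proof. by rewrite /rform symmx2_form. Qed.

Lemma sqnorm2 (v : 'rV[C]_2) : sqnorm v = sqmod (v 0 0) + sqmod (v 0 1).
Proof.
rewrite /sqnorm !big_ord_recl big_ord0 addr0.
by rewrite (_ : lift ord0 ord0 = 1) //; apply/val_inj.
Qed.

Lemma symmx2_tr a b c : \tr (symmx2 a b c) = (a + c)%:C.
Proof. by rewrite /mxtrace !big_ord_recl big_ord0 !mxE /= addr0 rmorphD. Qed.

Lemma symmx2_det a b c : \det (symmx2 a b c) = (a * c - b ^+ 2)%:C.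
Proof.
rewrite (expand_det_row _ 0) !big_ord_recl big_ord0 /cofactor !det_mx11 !mxE /=.
by rewrite mul1r mulN1r addr0 mulrN rmorphB rmorphM /= expr2 rmorphM.
Qed.

Lemma symmx2_posdef a b c : 0 < a -> 0 < a * c - b ^+ 2 ->
  posdefmx (symmx2 a b c).
Proof.
move=> a0 D0; split.
  apply/hermsymmxP/matrixP => i j; rewrite !mxE.
  have -> : (if j == i then if j == 0 then a else c else b) =
      (if i == j then if i == 0 then a else c else b).
    by rewrite eq_sym; case: eqVneq => // ->.
  by apply: conj_Creal; apply/complex_realP; eexists.
(* Completing the square gives nonnegativity here and definiteness in [q_gt0]. *)
have q_ge0 x y : 0 <= a * qform a b c x y.
  have -> : a * qform a b c x y =
      (a * x + b * y) ^+ 2 + (a * c - b ^+ 2) * y ^+ 2 by rewrite /qform; ring.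
  by rewrite addr_ge0 ?sqr_ge0 // mulr_ge0 ?sqr_ge0 // ltW.
have q_gt0 x y : qform a b c x y <= 0 -> x = 0 /\ y = 0.
  rewrite -(pmulr_rle0 _ a0).
  have -> : a * qform a b c x y =
      (a * x + b * y) ^+ 2 + (a * c - b ^+ 2) * y ^+ 2 by rewrite /qform; ring.
  move=> le0; have y0 : y = 0.
    apply/eqP; rewrite -sqrf_eq0 eq_le sqr_ge0 andbT -(pmulr_rle0 _ D0).
    by apply: le_trans le0; rewrite lerDr sqr_ge0.
  move: le0; rewrite y0 mulr0 addr0 expr0n mulr0 addr0 => le0.
  split=> //; have /eqP : (a * x) ^+ 2 = 0 by apply/eqP; rewrite eq_le le0 sqr_ge0.
  by rewrite sqrf_eq0 mulf_eq0 gt_eqF //= => /eqP.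
move=> v v0; rewrite symmx2_form ltcR ltNge; apply: contra v0 => le0.
have [q1 q2] : qform a b c (complex.Re (v 0 0)) (complex.Re (v 0 1)) <= 0 /\
    qform a b c (complex.Im (v 0 0)) (complex.Im (v 0 1)) <= 0.
  have := q_ge0 (complex.Re (v 0 0)) (complex.Re (v 0 1)).
  have := q_ge0 (complex.Im (v 0 0)) (complex.Im (v 0 1)).
  by rewrite !pmulr_rge0 // => ? ?; split; lra.
have [r0 r1] := q_gt0 _ _ q1; have [i0 i1] := q_gt0 _ _ q2.
have s0 : sqmod (v 0 0) = 0 by rewrite /sqmod r0 i0 expr0n addr0.
have s1 : sqmod (v 0 1) = 0 by rewrite /sqmod r1 i1 expr0n addr0.
apply/eqP/rowP => i; rewrite [RHS]mxE.
have [->|->] : i = 0 \/ i = 1; last exact: sqmod_eq0.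
- by case: i => [[|[|//]] ?]; [left|right]; apply/val_inj.
- exact: sqmod_eq0.
Qed.

(** The characteristic polynomial is nonpositive at [m], so [m] lies between the two eigenvalues and
    [powR_concave_bound] applies to each. The power is thus bounded by a form linear in [M], with an
    error that vanishes with the determinant, and without computing eigenvectors. *)
Lemma rform_mpow2_le (M : 'M[C]_2) (T D r m : R) v : posdefmx M ->
  \tr M = T%:C -> \det M = D%:C -> 0 < r <= 1 -> 0 < m ->
  m ^+ 2 - T * m + D <= 0 ->
  rform (mpow M r) v <= m `^ (r - 1) * rform M v + (D / m) `^ r * sqnorm v.
Proof.
move=> M0 trM detM r01 m0 mTD; have [U [d [UU d0 ME _]]] := posdef_ex_udiag M0.
have Uu := unitarymx_unit UU.
have trE : d 0 + d 1 = T.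
  apply: complexI; rewrite -trM ME /udiag mxtrace_mulC mulmxA mulmxV // mul1mx.
  rewrite mxtrace_diag !big_ord_recl big_ord0 !mxE addr0 rmorphD.
  by congr (_ + (d _)%:C); apply/val_inj.
have detE : d 0 * d 1 = D.
  apply: complexI; rewrite -detM ME /udiag !det_mulmx mulrAC -det_mulmx.
  rewrite mulVmx // det1 mul1r.
  rewrite det_diag !big_ord_recl big_ord0 !mxE mulr1 rmorphM.
  by congr (_ * (d _)%:C); apply/val_inj.
have d_le i : d i `^ r <= m `^ (r - 1) * d i + (D / m) `^ r.
  have [->|->] : i = 0 \/ i = 1.
  - by case: i => [[|[|//]] ?]; [left|right]; apply/val_inj.
  - by rewrite -detE; apply: powR_concave_bound => //; nra.
  - by rewrite -detE [d 0 * _]mulrC; apply: powR_concave_bound => //; nra.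
have -> : rform (mpow M r) v = \sum_i d i `^ r * sqmod ((v *m U ^t*) 0 i).
  by rewrite ME (mpow_udiag UU) (udiag_rform UU).
have -> : rform M v = \sum_i d i * sqmod ((v *m U ^t*) 0 i).
  by rewrite ME (udiag_rform UU).
rewrite -(sqnorm_unitary UU) /sqnorm.
rewrite !mulr_sumr -big_split /=; apply: ler_sum => i _.
by rewrite mulrA -mulrDl ler_wpM2r ?sqmod_ge0.
Qed.

End TwoByTwo.

(** * From top eigenvalues to quadratic forms *)

Section Comparison.
Local Open Scope sesquilinear_scope.
Local Open Scope complex_scope.
Set Implicit Arguments.
Unset Strict Implicit.
Variable R : realType.
Local Notation C := (R[i]).

Lemma posdef_convex n (a b : R) (A B : 'M[C]_n) : 0 < a -> 0 < b ->
  posdefmx A -> posdefmx B -> posdefmx (a%:C *: A + b%:C *: B).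
Proof.
move=> a0 b0 [Ah A0] [Bh B0]; split=> [|v v0].
  have realC c : (c%:C : C) \is Num.real by apply/complex_realP; exists c.
  apply/hermsymmxP/matrixP => i j.
  move/hermsymmxP/matrixP/(_ i j): Ah; move/hermsymmxP/matrixP/(_ i j): Bh.
  by rewrite !mxE rmorphD !rmorphM /= => -> ->; rewrite !conj_Creal.
have -> : (v *m (a%:C *: A + b%:C *: B) *m v ^t*) 0 0 =
    a%:C * (v *m A *m v ^t*) 0 0 + b%:C * (v *m B *m v ^t*) 0 0.
  by rewrite mulmxDr mulmxDl -!scalemxAr -!scalemxAl !mxE.
have vA := A0 v v0; have vB := B0 v v0.
by apply: addr_gt0; apply: mulr_gt0; rewrite ?ltcR.
Qed.

Lemma lam0_ge0 n (X : 'M[C]_n.+1) : posdefmx X -> 0 <= lam X 0.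
Proof.
move=> X0; have [U [d [_ d0 _ dE]]] := posdef_ex_udiag X0.
by have [i ->] := lam0_eigenvalue X; rewrite -dE ltW.
Qed.

Lemma wmaj_lam0 n (X Y : 'M[C]_n.+1) : wmaj X Y -> lam X 0 <= lam Y 0.
Proof. by move/(_ 1%N isT); rewrite 2!big_ord1. Qed.

(* Writing [A ^ p = P] and [B ^ p = X P X] gives [A ^ -p # B ^ p = X], so that
   [SG] is [(X ^ alpha P X ^ alpha) ^ (1 / p)]; [e] is a test vector for it. *)
Lemma lam0_SG_le_Amean n (alpha p q : R) (P X : 'M[C]_n.+1) e :
  0 < alpha < 1 -> 0 < p -> 0 < q -> posdefmx P -> posdefmx X ->
  e *m mpow X alpha = e -> sqnorm e = 1 -> 1 <= rform P e ->
  (let A := mpow P (1 / p) in let B := mpow (X *m P *m X) (1 / p) in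
    lam (SG alpha p A B) 0 <= lam (Amean alpha q A B) 0) ->
  exists v, sqnorm v = 1 /\
    1 <= (1 - alpha) * rform (mpow P (q / p)) v +
         alpha * rform (mpow (X *m P *m X) (q / p)) v.
Proof.
move=> /andP[alpha0 alpha1] p0 q0 P0 X0 eX e1 Pe /=.
have Q0 := posdef_congr X0 P0; have pn0 : p != 0 by rewrite gt_eqF.
have qn0 : q != 0 by rewrite gt_eqF.
rewrite /SG (mpowK pn0 P0) (mpowK pn0 Q0) /Amean (Falpha_riccati _ P0 X0).
rewrite (mpow_mpow _ _ P0) (mpow_mpow _ _ Q0) [1 / p * q]mulrC mulrA mulr1.
set Xa := mpow X alpha; set M := Xa *m P *m Xa.
set N := _ *: _ + _ *: _ => le_lam; rewrite -/Xa in eX.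
have Xa0 : posdefmx Xa by apply: posdef_mpow X0.
have M0 : posdefmx M by apply: posdef_congr Xa0 P0.
have N0 : posdefmx N.
  apply: posdef_convex (posdef_mpow _ P0) (posdef_mpow _ Q0); last exact: alpha0.
  by rewrite subr_gt0.
(* The power [Xa] is Hermitian and fixes [e], so it drops out of the form at [e]. *)
have Me : rform M e = rform P e.
  by rewrite /rform (form_congr P e (posdef_hermC Xa0)) eX.
(* Otherwise [rform_mpow_le] with exponent [p] would make the form of [M] at [e] less than 1. *)
have lamM : 1 <= lam (mpow M (1 / p)) 0.
  rewrite leNgt; apply/negP => lam_lt1; have Mp0 := posdef_mpow (1 / p) M0.
  have := rform_mpow_le e Mp0 (ltW p0).
  rewrite (mpowK pn0 M0) e1 mulr1 Me => /(le_trans Pe); apply/negP; rewrite -ltNge.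
  have l0 := lam0_ge0 Mp0.
  have := gt0_ltr_powR p0 l0 (ler01 : 1 \in Num.nneg) lam_lt1.
  by rewrite powR1.
(* A top unit eigenvector of [N ^ (1 / q)]: there the form of [N] is the [q]-th power of a number at
   least 1. *)
have [v [v1 vE]] := rform_mpow_lam0 q (posdef_mpow (1 / q) N0).
exists v; split; first exact: v1.
rewrite -[X in _ <= X + _]rformZ -rformZ -rformD -/N.
rewrite -[N](mpowK qn0 N0) vE.
have Nq0 := posdef_mpow (1 / q) N0; have l1 := le_trans lamM le_lam.
have := ge0_ler_powR (ltW q0) (ler01 : 1 \in Num.nneg) (lam0_ge0 Nq0) l1.
by rewrite powR1.
Qed.

Lemma symmx2_diag (d : 'I_2 -> R) : udiag 1%:M d = symmx2 (d 0) 0 (d 1).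
Proof.
rewrite /udiag invmx1 mul1mx mulmx1; apply/matrixP => i j; rewrite !mxE.
case: eqVneq => [->|_]; last by rewrite mulr0n.
rewrite mulr1n; case: eqVneq => [->|j0] //; congr (d _)%:C.
by case: j j0 => [[|[|//]] ?] // _; apply/val_inj.
Qed.

(** The first diagonal entry is 1, so the first basis vector can be the test vector [e] of
    [lam0_SG_le_Amean] whatever [alpha] is. *)
Lemma delta_mpow_diag (y t : R) :
  delta_mx 0 0 *m mpow (symmx2 1 0 y) t = delta_mx 0 0 :> 'rV[C]_2.
Proof.
pose d (i : 'I_2) := if i == 0 then 1 else y.
have U1 : (1%:M : 'M[C]_2) \is unitarymx.
  by apply/unitarymxP; rewrite trmx1 map_mx1 mulmx1.
have -> : symmx2 1 0 y = udiag 1%:M d by rewrite symmx2_diag.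
rewrite (mpow_udiag U1) symmx2_diag /d /= powR1; apply/rowP => j.
rewrite !mxE !big_ord_recl big_ord0 !mxE /= mul1r mul0r !addr0 eq_sym.
by case: eqVneq.
Qed.

Lemma sqnorm_delta : sqnorm (delta_mx 0 0 : 'rV[C]_2) = 1.
Proof. by rewrite sqnorm2 !mxE /sqmod /= !expr0n !expr1n !addr0. Qed.

Lemma rform_delta (a b c : R) : rform (symmx2 a b c) (delta_mx 0 0) = a.
Proof. by rewrite symmx2_rform !mxE /= /qform !expr0n !expr1n /=; ring. Qed.

Lemma symmx2_diag_congr (a b c y : R) :
  symmx2 1 0 y *m symmx2 a b c *m symmx2 1 0 y =
  symmx2 a (b * y) (c * y ^+ 2).
Proof.
apply/matrixP => i j; rewrite !mxE !big_ord_recl !big_ord0 !mxE.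
rewrite !big_ord_recl !big_ord0 !mxE.
case: i => [[|[|//]] ?]; case: j => [[|[|//]] ?] /=;
  apply/eqP; rewrite eq_complex /=; apply/andP; split; apply/eqP; ring.
Qed.

End Comparison.

(** * The degenerating pair and its limit *)

Section Degeneration.
Local Open Scope complex_scope.
Set Implicit Arguments.
Unset Strict Implicit.
Variable R : realType.
Local Notation C := (R[i]).

(** The two small quantities are the error terms of [rform_mpow_degP_le]; they also dominate those
    of [rform_mpow_degQ_le] when [h >= 1] and [r <= 1]. *)
Lemma ex_small (r c h : R) : 0 < r -> 0 < c -> 0 < h ->
  exists e, [/\ 0 < e, e <= 1, e * (h + 1) <= c & (2 * h * e) `^ r <= c].
Proof.
move=> r0 c0 h0; have cr0 : 0 < c `^ r^-1 by apply: powR_gt0.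
have h10 : 0 < h + 1 by lra.
have h20 : 0 < 2 * h by lra.
pose e := Num.min 1 (Num.min (c / (h + 1)) (c `^ r^-1 / (2 * h))).
have e0 : 0 < e by rewrite !lt_min ltr01 !divr_gt0.
have : e <= e by [].
rewrite {2}/e !le_min => /and3P[e1 e2 e3].
exists e; split=> //; first by rewrite -ler_pdivlMr.
have -> : c = (c `^ r^-1) `^ r by rewrite -powRrM mulVf ?gt_eqF // powRr1 // ltW.
apply: ge0_ler_powR; rewrite ?nnegrE ?(ltW r0) ?(ltW cr0) //.
  by rewrite !mulr_ge0 ?(ltW h0) ?(ltW e0).
by rewrite mulrC -ler_pdivlMr.
Qed.

Lemma qform_P_le (t e x y : R) : 0 < e -> e <= 1 ->
  qform (1 + e) (t * e) ((t ^+ 2 + e) * e ^+ 2) x y <=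
  x ^+ 2 + e * (t ^+ 2 + 2) * (x ^+ 2 + y ^+ 2).
Proof.
move=> e0 e1; rewrite -subr_ge0 /qform.
have -> : x ^+ 2 + e * (t ^+ 2 + 2) * (x ^+ 2 + y ^+ 2) -
  ((1 + e) * x ^+ 2 + 2 * (t * e) * x * y + (t ^+ 2 + e) * e ^+ 2 * y ^+ 2) =
  e * ((t * x - y) ^+ 2 + x ^+ 2 + t ^+ 2 * (1 - e) * y ^+ 2
   + (1 - e ^+ 2) * y ^+ 2) by ring.
apply: mulr_ge0; first exact: ltW.
have e2 : 0 <= 1 - e ^+ 2 by rewrite subr_ge0 expr_le1 // ltW.
have e1' : 0 <= 1 - e by rewrite subr_ge0.
have ty := mulr_ge0 (mulr_ge0 (sqr_ge0 t) e1') (sqr_ge0 y).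
by rewrite addr_ge0 ?(mulr_ge0 e2 (sqr_ge0 y)) // addr_ge0 // addr_ge0 ?sqr_ge0.
Qed.

(** This is the limit mixture at [e = 0]: with [w = (1, t)] of squared norm [h], the [r]-th power of
    [w w^T] is [h^(r-1) w w^T]. The identity minus the mixture has determinant
    [a (1 - k (1 + a t^2))], where [k = h^(r-1)]; it is positive once [h^(1-r)] exceeds the chord
    [1 + a (h - 1)], which [a < 1 - r] makes possible. *)
Lemma spectral_gap_ex (a r : R) : 0 < a < 1 -> 0 < r -> r < 1 - a ->
  exists h t c : R, [/\ 1 < h, t ^+ 2 = h - 1, 0 < c & forall x y : R,
    (1 - a) * x ^+ 2 + a * (h `^ (r - 1) * qform 1 t (t ^+ 2) x y) <=
    (1 - c) * (x ^+ 2 + y ^+ 2)].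
Proof.
move=> /andP[a0 a1] r0 ra.
have [h h1 hs] : exists2 h, 1 < h & 1 + a * (h - 1) < h `^ (1 - r).
  by apply: powR_gt_chord => //; lra.
have h0 : 0 < h by lra.
pose t := Num.sqrt (h - 1); have tE : t ^+ 2 = h - 1 by rewrite sqr_sqrtr; lra.
pose k := h `^ (r - 1); have k0 : 0 < k by apply: powR_gt0.
have kh : k * (1 + a * (h - 1)) < 1.
  by rewrite /k -opprB powRN mulrC ltr_pdivrMr ?powR_gt0 // mul1r.
have u0 : 0 < h - 1 by lra.
have kau : 0 < k * (a * (h - 1)) by rewrite !mulr_gt0.
rewrite mulrDr mulr1 in kh; have k1 : k < 1 by lra.
have A0 : 0 < a - a * k.
  have -> : a - a * k = a * (1 - k) by ring.
  by rewrite mulr_gt0 // subr_gt0.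
have D0 : 0 < 1 - a * k * t ^+ 2 by rewrite tE; lra.
have det0 : 0 < (a - a * k) * (1 - a * k * t ^+ 2) - (a * k * t) ^+ 2.
  have -> : (a - a * k) * (1 - a * k * t ^+ 2) - (a * k * t) ^+ 2 =
      a * (1 - k * (1 + a * t ^+ 2)) by ring.
  by rewrite tE [k * _]mulrDr mulr1 mulr_gt0 // subr_gt0.
(* Determinant over trace of the identity minus the mixture, as in [quadratic_ge]. *)
pose c := ((a - a * k) * (1 - a * k * t ^+ 2) - (a * k * t) ^+ 2) /
  ((a - a * k) + (1 - a * k * t ^+ 2)).
have c0 : 0 < c by rewrite divr_gt0 // addr_gt0.
exists h, t, c; split=> // x y.
by have := quadratic_ge x y A0 D0 det0; rewrite -/c -/k /qform; lra.
Qed.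

(** The congruence of [degQ t e] by diag(1, e), which flattens it onto the first axis as [e] tends
    to 0. *)
Definition degP (t e : R) : 'M[C]_2 :=
  symmx2 (1 + e) (t * e) ((t ^+ 2 + e) * e ^+ 2).

Definition degQ (t e : R) : 'M[C]_2 := symmx2 (1 + e) t (t ^+ 2 + e).

Section Pair.
Variables (t e : R).
Hypotheses (e_gt0 : 0 < e) (e_le1 : e <= 1).
Let h := t ^+ 2 + 1.

Let h_ge1 : 1 <= h. Proof. by rewrite lerDr sqr_ge0. Qed.

Let he_gt0 : 0 < h + e.
Proof. by apply: addr_gt0 => //; apply: lt_le_trans h_ge1. Qed.

Lemma degP_det :
  (1 + e) * ((t ^+ 2 + e) * e ^+ 2) - (t * e) ^+ 2 = e ^+ 3 * (h + e).
Proof. by rewrite /h; ring. Qed.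

Lemma degQ_det : (1 + e) * (t ^+ 2 + e) - t ^+ 2 = e * (h + e).
Proof. by rewrite /h; ring. Qed.

Lemma degP_posdef : posdefmx (degP t e).
Proof.
apply: symmx2_posdef; first by apply: addr_gt0.
by rewrite degP_det; apply: mulr_gt0 => //; apply: exprn_gt0.
Qed.

Lemma degQ_posdef : posdefmx (degQ t e).
Proof.
apply: symmx2_posdef; first by apply: addr_gt0.
by rewrite degQ_det; apply: mulr_gt0.
Qed.

Lemma degPQ : symmx2 1 0 e^-1 *m degP t e *m symmx2 1 0 e^-1 = degQ t e.
Proof.
rewrite symmx2_diag_congr mulfK ?gt_eqF // -mulrA -exprMn.
by rewrite mulfV ?gt_eqF // expr1n mulr1.
Qed.

Lemma degQP : symmx2 1 0 e *m degQ t e *m symmx2 1 0 e = degP t e.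
Proof. by rewrite symmx2_diag_congr. Qed.

Lemma rform_degP_le v : sqnorm v = 1 ->
  rform (degP t e) v <= sqmod (v 0 0) + e * (h + 1).
Proof.
move=> v1; rewrite symmx2_rform.
have re := qform_P_le t (complex.Re (v 0 0)) (complex.Re (v 0 1)) e_gt0 e_le1.
have im := qform_P_le t (complex.Im (v 0 0)) (complex.Im (v 0 1)) e_gt0 e_le1.
apply: le_trans (lerD re im) _; rewrite le_eqVlt; apply/orP; left; apply/eqP.
have -> : e * (h + 1) = e * (h + 1) * (sqmod (v 0 0) + sqmod (v 0 1)).
  by rewrite -sqnorm2 v1 mulr1.
by rewrite /sqmod /h; ring.
Qed.

Lemma rform_degQ v : sqnorm v = 1 ->
  rform (degQ t e) v = rform (symmx2 1 t (t ^+ 2)) v + e.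
Proof.
move=> v1; have eE : e = e * (sqmod (v 0 0) + sqmod (v 0 1)).
  by rewrite -sqnorm2 v1 mulr1.
by rewrite !symmx2_rform [in RHS]eE /sqmod /qform; ring.
Qed.

Lemma rform_mpow_degP_le (r : R) v : 0 < r <= 1 -> sqnorm v = 1 ->
  rform (mpow (degP t e) r) v <=
  sqmod (v 0 0) + e * (h + 1) + (2 * h * e) `^ r.
Proof.
move=> r01 v1; have [r0 _] := andP r01.
have e3 : e ^+ 3 <= e by rewrite exprS ger_pMr // exprn_ile1 // ltW.
have e30 : 0 <= e ^+ 3 by rewrite exprn_ge0 // ltW.
have cond : 1 ^+ 2 - (1 + e + (t ^+ 2 + e) * e ^+ 2) * 1 +
    ((1 + e) * ((t ^+ 2 + e) * e ^+ 2) - (t * e) ^+ 2) <= 0.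
  have -> : 1 ^+ 2 - (1 + e + (t ^+ 2 + e) * e ^+ 2) * 1 +
    ((1 + e) * ((t ^+ 2 + e) * e ^+ 2) - (t * e) ^+ 2) =
    - (e * (1 - e ^+ 3) + t ^+ 2 * e ^+ 2 * (1 - e)) by ring.
  have e3' : 0 <= 1 - e ^+ 3 by rewrite subr_ge0 (le_trans e3).
  have e1' : 0 <= 1 - e by rewrite subr_ge0.
  have te := mulr_ge0 (mulr_ge0 (sqr_ge0 t) (sqr_ge0 e)) e1'.
  by rewrite oppr_le0 addr_ge0 // mulr_ge0 // ltW.
have := rform_mpow2_le v degP_posdef (symmx2_tr _ _ _) (symmx2_det _ _ _) r01
  ltr01 cond.
rewrite powR1 mul1r v1 mulr1 divr1 degP_det => /le_trans; apply.
apply: lerD; first exact: rform_degP_le.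
have he2 : h + e <= 2 * h by rewrite mulr2n mulrDl mul1r lerD2l (le_trans e_le1).
apply: (ge0_ler_powR (ltW r0)); rewrite ?nnegrE.
- exact: mulr_ge0 e30 (ltW he_gt0).
- by rewrite mulr_ge0 ?(ltW e_gt0) // (le_trans _ he2) // ltW.
- by rewrite mulrC; apply: ler_pM => //; apply: ltW.
Qed.

(** The eigenvalues of [degQ] are [e] and [h + e], so [m = h] separates them because [e <= 1 <= h].
    The error is bounded crudely to match the one for [degP]. *)
Lemma rform_mpow_degQ_le (r : R) v : 0 < r <= 1 -> sqnorm v = 1 ->
  rform (mpow (degQ t e) r) v <=
  h `^ (r - 1) * (rform (symmx2 1 t (t ^+ 2)) v + e) + (2 * h * e) `^ r.
Proof.
move=> r01 v1; have [r0 _] := andP r01.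
have h0 : 0 < h by apply: lt_le_trans h_ge1.
have cond : h ^+ 2 - (1 + e + (t ^+ 2 + e)) * h +
    ((1 + e) * (t ^+ 2 + e) - t ^+ 2) <= 0.
  have -> : h ^+ 2 - (1 + e + (t ^+ 2 + e)) * h +
      ((1 + e) * (t ^+ 2 + e) - t ^+ 2) = - (e * (h - e)) by rewrite /h; ring.
  by rewrite oppr_le0 mulr_ge0 ?subr_ge0 ?(le_trans e_le1) // ltW.
have := rform_mpow2_le v degQ_posdef (symmx2_tr _ _ _) (symmx2_det _ _ _) r01
  h0 cond.
rewrite -(rform_degQ v1) v1 mulr1 degQ_det => /le_trans; apply; rewrite lerD2l.
have he2 : h + e <= 2 * h by rewrite mulr2n mulrDl mul1r lerD2l (le_trans e_le1).
apply: (ge0_ler_powR (ltW r0)); rewrite ?nnegrE.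
- by rewrite divr_ge0 ?mulr_ge0 ?(ltW e_gt0) ?(ltW he_gt0) ?(ltW h0).
- by rewrite mulr_ge0 ?(ltW e_gt0) // (le_trans _ he2) // ltW.
rewrite ler_pdivrMr // mulrAC mulrC ler_pM2r //.
by apply: le_trans he2 _; rewrite ler_peMr // mulr_ge0 // ltW.
Qed.

End Pair.

Lemma ex_degenerate_pair (a r : R) : 0 < a < 1 -> 0 < r -> r < 1 - a ->
  exists t e : R, [/\ 0 < e, e <= 1 & forall v, sqnorm v = 1 ->
    (1 - a) * rform (mpow (degP t e) r) v +
    a * rform (mpow (degQ t e) r) v < 1].
Proof.
move=> a01 r0 ra; have [h [t [c [h1 tE c0 gap]]]] := spectral_gap_ex a01 r0 ra.
have [a0 a1] := andP a01.
have h0 : 0 < h by apply: lt_trans h1.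
have r1 : r < 1 by apply: lt_trans ra _; rewrite gtrBl.
(* Each of the two bounds carries two errors of at most [c / 3]. The weights [1 - a] and [a] sum to
   1, so the total error is [2 * (c / 3)], less than the gap [c]. *)
have c3 : 0 < c / 3 by apply: divr_gt0.
have [e [e0 e1 eh er]] := ex_small r0 c3 h0.
exists t, e; split=> // v v1.
have r01 : 0 < r <= 1 by rewrite r0 ltW.
have hE : h = t ^+ 2 + 1 by rewrite tE subrK.
have boundP := rform_mpow_degP_le t e0 e1 r01 v1.
have boundQ := rform_mpow_degQ_le t e0 e1 r01 v1.
move: (rform (mpow _ r) v) boundP => fP; move: (rform (mpow _ r) v) boundQ => fQ.
rewrite -hE => boundQ boundP.
have k1 : h `^ (r - 1) <= 1.
  have r1' : r - 1 <= 0 by rewrite subr_le0 ltW.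
  by have := ler_powR (ltW h1) r1'; rewrite powRr0.
have k0 : 0 <= h `^ (r - 1) by apply: powR_ge0.
have xy1 : sqmod (v 0 0) + sqmod (v 0 1) = 1 by rewrite -sqnorm2.
rewrite symmx2_rform in boundQ; rewrite /sqmod in xy1 boundP.
have gap1 := gap (complex.Re (v 0 0)) (complex.Re (v 0 1)).
have gap2 := gap (complex.Im (v 0 0)) (complex.Im (v 0 1)).
set k := h `^ (r - 1) in k0 k1 boundQ gap1 gap2.
set w := (2 * h * e) `^ r in er boundP boundQ.
set x1 := complex.Re (v 0 0) in xy1 boundP boundQ gap1.
set x2 := complex.Im (v 0 0) in xy1 boundP boundQ gap2.
set y1 := complex.Re (v 0 1) in xy1 boundQ gap1.
set y2 := complex.Im (v 0 1) in xy1 boundQ gap2.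
set q1 := qform 1 t _ x1 y1 in boundQ gap1.
set q2 := qform 1 t _ x2 y2 in boundQ gap2.
have ke : k * e <= e by rewrite ger_pMl.
have eh' : e <= e * (h + 1) by rewrite ler_peMr ?(ltW e0) // lerDr ltW.
have a1' : 0 <= 1 - a by rewrite subr_ge0 ltW.
have boundP' : fP <= x1 ^+ 2 + x2 ^+ 2 + 2 * (c / 3).
  by apply: le_trans boundP _; rewrite -addrA lerD2l mulr2n mulrDl !mul1r lerD.
have boundQ' : fQ <= k * (q1 + q2) + 2 * (c / 3).
  apply: le_trans boundQ _.
  rewrite mulrDr -addrA lerD2l mulr2n mulrDl !mul1r lerD //.
  by rewrite (le_trans ke) // (le_trans eh').
have mixP := ler_wpM2l a1' boundP'; have mixQ := ler_wpM2l (ltW a0) boundQ'.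
apply: le_lt_trans (lerD mixP mixQ) _.
have -> : (1 - a) * (x1 ^+ 2 + x2 ^+ 2 + 2 * (c / 3)) +
    a * (k * (q1 + q2) + 2 * (c / 3)) =
  ((1 - a) * x2 ^+ 2 + a * (k * q2)) + ((1 - a) * x1 ^+ 2 + a * (k * q1)) +
    2 * (c / 3) by ring.
apply: le_lt_trans (lerD (lerD gap2 gap1) (lexx _)) _.
have -> : (1 - c) * (x2 ^+ 2 + y2 ^+ 2) + (1 - c) * (x1 ^+ 2 + y1 ^+ 2) +
    2 * (c / 3) =
  (1 - c) * (x1 ^+ 2 + x2 ^+ 2 + (y1 ^+ 2 + y2 ^+ 2)) + 2 * (c / 3) by ring.
have -> : (1 - c) * (x1 ^+ 2 + x2 ^+ 2 + (y1 ^+ 2 + y2 ^+ 2)) = 1 - c.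
  by rewrite xy1 mulr1.
by clear - c0; lra.
Qed.

End Degeneration.

(** * The two lower bounds on [q / p] *)

Theorem theorem4p27 (R : realType) (alpha p q : R) :
  0 < alpha < 1 -> 0 < p -> 0 < q ->
  ((forall A B : 'M[R[i]]_2, posdefmx A -> posdefmx B ->
      lam (SG alpha p A B) 0 <= lam (Amean alpha q A B) 0) ->
     Num.max alpha (1 - alpha) <= q / p)
  /\
  ((forall A B : 'M[R[i]]_2, posdefmx A -> posdefmx B ->
      wmaj (SG alpha p A B) (Amean alpha q A B)) ->
     Num.max alpha (1 - alpha) <= q / p).
Proof.
move=> alpha01 p0 q0.
set concl := _ <= q / p; suff main : (forall A B : 'M[R[i]]_2,
    posdefmx A -> posdefmx B ->
    lam (SG alpha p A B) 0 <= lam (Amean alpha q A B) 0) -> concl.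
  split=> // H; apply: main => A B A0 B0.
  exact: wmaj_lam0 (H A B A0 B0).
move=> H; have r0 : 0 < q / p by apply: divr_gt0.
have [alpha0 alpha1] := andP alpha01.
(* The hypothesis at [A = P ^ (1 / p)] and [B = Q ^ (1 / p)], with diag(1, y) as the Riccati
   solution. *)
have violation (P Q : 'M[R[i]]_2) (y : R) : 0 < y -> posdefmx P ->
    symmx2 1 0 y *m P *m symmx2 1 0 y = Q ->
    1 <= rform P (delta_mx 0 0) ->
    exists v, sqnorm v = 1 /\
      1 <= (1 - alpha) * rform (mpow P (q / p)) v +
           alpha * rform (mpow Q (q / p)) v.
  move=> y0 P0 <- Pe.
  have X0 : posdefmx (symmx2 1 0 y : 'M[R[i]]_2).
    by apply: symmx2_posdef; rewrite // expr0n subr0 mul1r.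
  apply: (lam0_SG_le_Amean alpha01 p0 q0 P0 X0 (delta_mpow_diag y alpha)
    (sqnorm_delta R) Pe).
  apply: H; first exact: posdef_mpow P0.
  exact: posdef_mpow (posdef_congr X0 P0).
rewrite /concl ge_max !leNgt -negb_or; apply/negP => /orP[r_lt|r_lt].
(* If [q / p < alpha], the pair is built for the weight [1 - alpha] and used in reverse order:
   [degQ] plays [P], and diag(1, e) carries it to [degP]. *)
- have beta01 : 0 < 1 - alpha < 1 by rewrite subr_gt0 alpha1 gtrBl.
  have betaK : 1 - (1 - alpha) = alpha by rewrite opprB addrC subrK.
  have [|t [e [e0 e1 mix_lt]]] := ex_degenerate_pair beta01 r0.
    by rewrite betaK.
  have Qe : 1 <= rform (degQ t e) (delta_mx 0 0).
    by rewrite rform_delta lerDl ltW.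
  have [v [v1 mix_ge]] :=
    violation _ _ e e0 (degQ_posdef t e0) (degQP t e) Qe.
  have lt1 := mix_lt v v1; rewrite betaK [X in X < _]addrC in lt1.
  by have := le_lt_trans mix_ge lt1; rewrite ltxx.
(* If [q / p < 1 - alpha], the pair is used directly, and diag(1, 1/e) carries [degP] to [degQ]. *)
- have [t [e [e0 e1 mix_lt]]] := ex_degenerate_pair alpha01 r0 r_lt.
  have Pe : 1 <= rform (degP t e) (delta_mx 0 0).
    by rewrite rform_delta lerDl ltW.
  have Ve0 : 0 < e^-1 by rewrite invr_gt0.
  have [v [v1 mix_ge]] :=
    violation _ _ e^-1 Ve0 (degP_posdef t e0) (degPQ t e0) Pe.
  by have := le_lt_trans mix_ge (mix_lt v v1); rewrite ltxx.
Qed.
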